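(* Let $C,D \subset \mathbb{R}$ be finite sets and let $\lambda,\mu \in \mathbb{R}\setminus\{0\}$ be fixed. Let $\mathcal{L} \subset \mathrm{Aff}(\mathbb{R})$ be the set of lines \[ \mathcal{L}=\left\{\left(\frac{\lambda}{c-d}, \frac{\mu c}{c-d}\right) : c \in C,\ d \in D,\ c \neq d\right\}. \] Then \[ E(\mathcal{L}) \ll |C|^{5/2}|D|^{5/2} + |C|^4 + |D|^4 . \]
   Context: A non-vertical line $y=mx+c$ with $m\neq 0$ is identified with the element $(m,c)$ of the affine group $\mathrm{Aff}(\mathbb{R})=\{(m,c): m\in\mathbb{R}\setminus\{0\}, c\in\mathbb{R}\}$, with multiplication $(a,b)\cdot(c,d)=(ac,ad+b)$ (so $(a,b)^{-1}=(1/a,-b/a)$). For a finite set $\mathcal{L}\subset \mathrm{Aff}(\mathbb{R})$, its energy $E(\mathcal{L})$ is the number of quadruples $(l_1,l_2,l_3,l_4)\in\mathcal{L}^4$ with $l_1^{-1}l_2=l_3^{-1}l_4$; equivalently $E(\mathcal{L})=\sum_{l} r(l)^2$ where $r(l)$ is the number of pairs $(l_1,l_2)\in\mathcal{L}^2$ with $l_1^{-1}l_2=l$. The notation $X\ll Y$ means $X\le cY$ for an absolute constant $c>0$. *)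

(* Defs.v *)
From HB Require Import structures.
From mathcomp Require Import all_boot all_order all_algebra.
From mathcomp Require Import finmap.
From mathcomp Require Import reals exp.
Set Implicit Arguments.
Unset Strict Implicit.
Unset Printing Implicit Defensive.
Import Order.TTheory GRing.Theory Num.Theory.
Local Open Scope fset_scope.
Local Open Scope ring_scope.

(* aff F is Aff(F): the pair (m, c) with m != 0 stands for y = m x + c. *)
Record aff (F : fieldType) := Aff {
  aff_val :> F * F;
  _ : aff_val.1 != 0
}.

HB.instance Definition _ (F : fieldType) := [isSub for @aff_val F].
HB.instance Definition _ (F : fieldType) := [Choice of aff F by <:].

Section AffineGroup.
Variable F : fieldType.
Implicit Types l : aff F.

Lemma aff_slope_neq0 l : (val l).1 != 0.
Proof. exact: valP l. Qed.

Definition aff_one : aff F := @Aff F (1, 0) (oner_neq0 F).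

Definition aff_mul l1 l2 : aff F :=
  @Aff F ((val l1).1 * (val l2).1, (val l1).1 * (val l2).2 + (val l1).2)
    (mulf_neq0 (aff_slope_neq0 l1) (aff_slope_neq0 l2)).

Definition aff_inv l : aff F :=
  @Aff F ((val l).1^-1, - (val l).2 / (val l).1)
    (invr_neq0 (aff_slope_neq0 l)).

Lemma aff_mulA : associative aff_mul.
Proof.
move=> l1 l2 l3; apply: val_inj => /=.
by rewrite mulrA mulrDr mulrA addrA.
Qed.

Lemma aff_mul1 : left_id aff_one aff_mul.
Proof.
by case=> [[m c] m0]; apply: val_inj; rewrite /= !mul1r addr0.
Qed.

Lemma aff_mulr1 : right_id aff_one aff_mul.
Proof.
by case=> [[m c] m0]; apply: val_inj; rewrite /= mulr1 mulr0 add0r.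
Qed.

Lemma aff_mulV : left_inverse aff_one aff_inv aff_mul.
Proof.
case=> [[m c] m0]; apply: val_inj => /=.
by rewrite mulVf // mulNr [c / m]mulrC subrr.
Qed.

Lemma aff_mulrV : right_inverse aff_one aff_inv aff_mul.
Proof.
case=> [[m c] m0]; apply: val_inj => /=.
by rewrite mulfV // mulrC divfK // addNr.
Qed.

HB.instance Definition _ := isGroup.Build (aff F)
  aff_mulA aff_mul1 aff_mulr1 aff_mulV aff_mulrV.

End AffineGroup.

Definition energy (G : groupType) (A : {fset G}) : nat :=
  #|` [fset q in (A `*` A) `*` (A `*` A)
       | (q.1.1^-1 * q.1.2 == q.2.1^-1 * q.2.2)%g] |.

Section Lines.
Variable F : fieldType.
Implicit Types (C D : {fset F}) (lambda mu c d : F).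

(* The default value aff_one is returned only when m = 0; in lines below the
   slope lambda / (c - d) is nonzero as soon as lambda is (see linesP). *)
Definition mk_line (m b : F) : aff F := insubd (aff_one F) (m, b).

Definition lines C D lambda mu : {fset aff F} :=
  [fset mk_line (lambda / (cd.1 - cd.2)) (mu * cd.1 / (cd.1 - cd.2))
   | cd in [fset cd in C `*` D | cd.1 != cd.2]].

Lemma linesP C D lambda mu (l : aff F) : lambda != 0 ->
  reflect (exists c d, [/\ c \in C, d \in D, c != d
             & val l = (lambda / (c - d), mu * c / (c - d))])
          (l \in lines C D lambda mu).
Proof.
move=> l0; apply: (iffP idP) => [/imfsetP[[c d] /=]|[c [d [Cc Dd cd lE]]]].
  rewrite !inE /= => /andP[/andP[Cc Dd] cd] ->; exists c, d; split=> //.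
  rewrite /mk_line insubdK // unfold_in /= mulf_neq0 // invr_neq0 //.
  by rewrite subr_eq0.
apply/imfsetP; exists (c, d); first by rewrite /= !inE /= Cc Dd.
by rewrite /mk_line -lE valKd.
Qed.

End Lines.

(* Main.v *)
Require Import Defs.
From mathcomp Require Import all_boot all_order all_algebra.
From mathcomp Require Import finmap.
From mathcomp Require Import reals exp.
From mathcomp Require Import zify ring lra.
Set Implicit Arguments.
Unset Strict Implicit.
Unset Printing Implicit Defensive.
Import Order.TTheory GRing.Theory Num.Theory.

(** Comparing slopes and intercepts shows that [l1^-1 * l2 = g] exactly when a
    single affine map attached to [g] sends [(c2, d2)] to [(c1, d1)]. Hence the
    number [r g] of representations of [g] is at most [rC g * rD g], the product
    of the numbers of points of [C * C] and [D * D] on a common line, and the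
    energy is the sum of the [r g ^ 2].

    For a grid [A * A] with [#|A| = n], cut each side into [s] blocks. A line of
    nonzero slope is monotone, so it meets fewer than [2 s] of the [s^2] cells;
    if it has [k >= 4 s] points, at least [k / 2] pairs of its points share a
    cell. There are about [n^4 / s^2] such pairs, and each determines its line,
    so taking [s] close to [k / 4] gives [O(n^4 / k^3)] lines with [k] points
    or more. Summing over [k] bounds the fourth moment of the number of points
    per line (over lines with at least two) by [O(n^5)], and Cauchy-Schwarz
    handles the [g] with [rC g, rD g >= 2]. The other [g] contribute
    [O(|C|^4 + |D|^4)], trivially. *)

(** * Double counting and pigeonhole on finite types *)

Section FiniteCounting.
Local Open Scope nat_scope.

Lemma sum_card_disjoint_le (I T : finType) (P : I -> {set T}) (U : {set T}) :
  (forall i, P i \subset U) ->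
  (forall i j u, u \in P i -> u \in P j -> i = j) ->
  \sum_i #|P i| <= #|U|.
Proof.
move=> sPU dP; rewrite -[#|U|]sum1_card.
under eq_bigr => i _ do rewrite -sum1_card.
rewrite (exchange_big_dep (mem U)) /=; last by move=> i u _; apply/subsetP.
apply: leq_sum => u _; rewrite sum1_card; apply/card_le1_eqP => i j Pi Pj.
by apply: (dP _ _ u).
Qed.

(** Choose a representative in each fibre of [f] on [S]. The representatives inject into [J], and
    every other point forms a collision with its representative. *)
Lemma card_le_collisions (T J : finType) (f : T -> J) (S : {set T}) :
  #|S| <= #|J| + #|[set u : T * T | [&& u.1 \in S, u.2 \in S, u.1 != u.2
                                      & f u.1 == f u.2]]|.
Proof.
pose rep v := [pick q in S | f q == v].
rewrite -(cardsID [set p | rep (f p) == Some p] S); apply: leq_add.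
  apply: (leq_card_in f) => p q; rewrite !inE.
  by move=> /andP[_ /eqP rp] /andP[_ /eqP rq] fpq; move: rp; rewrite fpq rq => -[].
pose g p := (p, odflt p (rep (f p))).
rewrite -(card_in_imset (f := g)) => [|p q _ _ []//].
apply/subset_leq_card/subsetP => _ /imsetP[p + ->].
rewrite !inE /g /= => /andP[rp Sp]; rewrite Sp /=.
move: rp; rewrite /rep; case: pickP => [q /andP[-> /eqP ->] qp|/(_ p)] /=.
  by rewrite eqxx andbT; apply: contra qp => /eqP ->.
by rewrite /= Sp eqxx.
Qed.

Lemma card_fiber_pairs (T I : finType) (h : T -> I) :
  #|[set q : T * T | h q.1 == h q.2]| = \sum_i #|[set x | h x == i]| ^ 2.
Proof.
rewrite -sum1_card (partition_big (fun q => h q.1) predT) //=.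
apply: eq_bigr => i _; rewrite sum1_card -mulnn -cardsX.
apply: eq_card => -[x y]; rewrite !inE /= unfold_in /= inE /=.
by rewrite andbC; case: eqP => // ->; rewrite eq_sym.
Qed.

Lemma sum_card_fibers (T I : finType) (h : T -> I) :
  \sum_i #|[set x | h x == i]| = #|T|.
Proof.
rewrite -[RHS]sum1_card (partition_big h predT) //=.
by apply: eq_bigr => i _; rewrite -sum1_card; apply: eq_bigl => x; rewrite inE.
Qed.

End FiniteCounting.

(** * Rich monotone curves in a finite grid, two points determining the curve *)

Section MonotoneGridCurves.
Local Open Scope nat_scope.
Variables (T I : finType) (rk : T -> nat) (S : I -> {set T * T}).
Hypothesis rk_inj : injective rk.
Hypothesis rk_lt : forall x, rk x < #|T|.
Hypothesis S_mono : forall i,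
  {in S i &, forall p q, (rk p.1 <= rk q.1) = (rk p.2 <= rk q.2)} \/
  {in S i &, forall p q, (rk p.1 <= rk q.1) = (rk q.2 <= rk p.2)}.
Hypothesis S_lin : forall i j p q, p != q ->
  p \in S i -> q \in S i -> p \in S j -> q \in S j -> i = j.

Let n := #|T|.

Lemma curve_fst_inj i : {in S i &, injective (fun p => p.1)}.
Proof.
move=> [x y] [x' y'] Sp Sq /= xx'; subst x'; congr (_, _); apply: rk_inj.
case: (S_mono i) => mono; have := mono _ _ Sp Sq; have := mono _ _ Sq Sp => /=;
  rewrite !leqnn => /esym le1 /esym le2; apply/eqP; rewrite eqn_leq.
  by rewrite le1 le2.
by rewrite le1 le2.
Qed.

Lemma card_curve_le i : #|S i| <= n.
Proof. exact: leq_card_in (@curve_fst_inj i). Qed.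

Definition curve_pairs (E : {set (T * T) * (T * T)}) i :=
  [set u in E | [&& u.1 \in S i, u.2 \in S i & u.1 != u.2]].

(** By [S_lin], a pair of distinct points lies on at most one curve, so no pair is counted twice. *)
Lemma sum_curve_pairs E : \sum_i #|curve_pairs E i| <= #|E|.
Proof.
apply: sum_card_disjoint_le => [i|i j u].
  by apply/subsetP => u; rewrite inE => /andP[].
rewrite !inE => /andP[_ /and3P[u1 u2 u12]] /andP[_ /and3P[v1 v2 _]].
exact: S_lin u12 u1 u2 v1 v2.
Qed.

(** A curve with [r >= 2] points carries [r ^ 2 - r >= r ^ 2 / 2] ordered pairs of distinct points,
    and the grid has [n ^ 4] pairs in all. *)
Lemma sum_sqr_card_curve : \sum_(i | 2 <= #|S i|) #|S i| ^ 2 <= 2 * n ^ 4.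
Proof.
have h : forall i, 2 <= #|S i| -> #|S i| ^ 2 <= 2 * #|curve_pairs setT i|.
  move=> i Si.
  have : #|S i| ^ 2 <= #|curve_pairs setT i| + #|S i|.
    rewrite -mulnn -cardsX -(cardsID [set u | u.1 != u.2] (setX _ _)).
    apply: leq_add.
      by apply/subset_leq_card/subsetP => u; rewrite !inE => /andP[/andP[-> ->] ->].
    rewrite -(card_in_imset (f := fun p => (p, p)) (D := S i)) => [|p q _ _ []//].
    apply/subset_leq_card/subsetP => -[p q]; rewrite !inE negbK /=.
    by case/and3P => /eqP-> _ Sq; apply/imsetP; exists q.
  by nia.
apply: leq_trans (leq_sum _ h) _; rewrite -big_distrr /= leq_mul2l /=.
apply: leq_trans (_ : \sum_i #|curve_pairs setT i| <= _).
  by rewrite [leqRHS](bigID (fun i => 2 <= #|S i|)) leq_addr.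
apply: leq_trans (sum_curve_pairs _) _.
by rewrite cardsT !card_prod /n; lia.
Qed.

Definition same_cell w :=
  [set u : (T * T) * (T * T) | (rk u.1.1 %/ w == rk u.2.1 %/ w)
                            && (rk u.1.2 %/ w == rk u.2.2 %/ w)].

(** The first point fixes the quotients of the ranks of the second, which is then determined by two
    residues modulo the cell width [w.+1]. *)
Lemma card_same_cell w : #|same_cell w.+1| <= n ^ 2 * w.+1 ^ 2.
Proof.
pose f (u : (T * T) * (T * T)) : (T * T) * ('I_w.+1 * 'I_w.+1) :=
  (u.1, (inord (rk u.2.1 %% w.+1), inord (rk u.2.2 %% w.+1))).
apply: leq_trans (leq_card_in f _ _) _; last first.
  by rewrite !card_prod card_ord !mulnn.
move=> [[x y] [z t]] [[x' y'] [z' t']]; rewrite !inE /f /=.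
move=> /andP[/eqP e1 /eqP e2] /andP[/eqP e3 /eqP e4] [ex ey ez et].
subst x' y'; congr (_, (_, _)); apply: rk_inj.
  rewrite (divn_eq (rk z) w.+1) (divn_eq (rk z') w.+1) -e1 -e3.
  by congr addn; move/(congr1 val): ez; rewrite /= !inordK // ltn_mod.
rewrite (divn_eq (rk t) w.+1) (divn_eq (rk t') w.+1) -e2 -e4.
by congr addn; move/(congr1 val): et; rewrite /= !inordK // ltn_mod.
Qed.

(* The cells visited by a monotone curve form a chain, which the sum (or, for
   a decreasing curve, the difference) of the two cell indices embeds into an
   interval of length [2 s + 1]; here there are [s + 1] cells per side. *)
Lemma curve_same_cell_pairs s w i : n <= s.+1 * w.+1 ->
  #|S i| <= (2 * s).+1 + #|curve_pairs (same_cell w.+1) i|.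
Proof.
move=> nsw.
have cell_le x : rk x %/ w.+1 <= s.
  by rewrite -ltnS ltn_divLR //; apply: leq_trans (rk_lt x) nsw.
have cell_mono x y : rk x <= rk y -> rk x %/ w.+1 <= rk y %/ w.+1.
  exact: leq_div2r.
have fin (f : T * T -> nat) : (forall p, f p <= 2 * s) ->
    {in S i &, forall p q, f p = f q -> (p, q) \in same_cell w.+1} ->
    #|S i| <= (2 * s).+1 + #|curve_pairs (same_cell w.+1) i|.
  move=> f_le f_cell.
  have := card_le_collisions (fun p => inord (f p) : 'I_(2 * s).+1) (S i).
  rewrite card_ord => /leq_trans; apply; rewrite leq_add2l.
  apply/subset_leq_card/subsetP => -[p q]; rewrite !in_set /=.
  case/and4P => Sp Sq pq /eqP/(congr1 val); rewrite /= !inordK ?ltnS // => fpq.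
  by rewrite Sp Sq pq !andbT; have := f_cell p q Sp Sq fpq; rewrite inE.
case: (S_mono i) => mono.
  apply: (fin (fun p => rk p.1 %/ w.+1 + rk p.2 %/ w.+1)) => [p|p q Sp Sq /= fpq].
    by have := cell_le p.1; have := cell_le p.2; lia.
  rewrite inE /=; case/orP: (leq_total (rk p.1) (rk q.1)) => le1.
    have := le1; rewrite (mono _ _ Sp Sq) => le2.
    by have := cell_mono _ _ le1; have := cell_mono _ _ le2; lia.
  have := le1; rewrite (mono _ _ Sq Sp) => le2.
  by have := cell_mono _ _ le1; have := cell_mono _ _ le2; lia.
(* Shifting by [s] keeps the difference of indices in [nat]; no truncation occurs, since [cell_le]
   bounds each index by [s]. *)
apply: (fin (fun p => rk p.1 %/ w.+1 + (s - rk p.2 %/ w.+1))) => [p|p q Sp Sq /= fpq].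
  by rewrite mul2n -addnn leq_add ?leq_subr ?cell_le.
have := cell_le p.2; have := cell_le q.2.
rewrite inE /=; case/orP: (leq_total (rk p.1) (rk q.1)) => le1.
  have := le1; rewrite (mono _ _ Sp Sq) => le2.
  by have := cell_mono _ _ le1; have := cell_mono _ _ le2; lia.
have := le1; rewrite (mono _ _ Sq Sp) => le2.
by have := cell_mono _ _ le1; have := cell_mono _ _ le2; lia.
Qed.

Lemma card_rich_curves k : 2 <= k ->
  #|[set i | k <= #|S i|]| * k ^ 3 <= 200 * n ^ 4.
Proof.
move=> k2; set N := [set i | _].
(* A rich curve [i0] yields [k <= n], hence [s.+1 <= n], which bounds the rounding loss in [ws]
   below. *)
have [->|[i0 Ni0]] := set_0Vmem N; first by rewrite cards0.
have kn : k <= n by move: Ni0; rewrite inE => /leq_trans; apply; exact: card_curve_le.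
(* The first inequality makes the loss [(2 * s).+1] at most [k / 2], so a rich curve keeps at least
   [k / 2] same-cell pairs; the second trades [k ^ 2] for [25 * s.+1 ^ 2]. *)
have [s [s4 ks]] : exists s, 4 * s + 2 <= k /\ k <= 5 * s.+1.
  by exists ((k + 2) %/ 4).-1; lia.
have nw : n <= s.+1 * (n %/ s.+1).+1.
  by rewrite mulnC ltnW // {1}(divn_eq n s.+1) mulSn addnC ltn_add2r ltn_mod.
set w := n %/ s.+1 in nw *.
have ws : s.+1 * w.+1 <= 2 * n.
  have : w * s.+1 <= n by exact: leq_trunc_div.
  by lia.
have le1 : #|N| * k <= 2 * (n ^ 2 * w.+1 ^ 2).
  apply: leq_trans (_ : 2 * \sum_i #|curve_pairs (same_cell w.+1) i| <= _); last first.
    by rewrite leq_mul2l /=; apply: leq_trans (sum_curve_pairs _) (card_same_cell _).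
  rewrite -sum_nat_const big_distrr /=.
  rewrite [leqRHS](bigID (mem N)) /=; apply: leq_trans (leq_addr _ _).
  apply: leq_sum => i; rewrite inE => ki.
  have := curve_same_cell_pairs i nw; move: ki.
  by move: #|S i| #|curve_pairs _ _| => a b; lia.
have le2 : k ^ 2 <= 25 * s.+1 ^ 2 by nia.
have le3 : s.+1 ^ 2 * w.+1 ^ 2 <= 4 * n ^ 2.
  by rewrite -expnMn -[4]/(2 ^ 2) -expnMn leq_exp2r.
(* The constant is [200 = 2 * 25 * 4], one factor from each of [le1], [le2] and [le3]. *)
have := leq_mul le1 le2; rewrite -mulnA -expnS => /leq_trans; apply.
have := leq_mul (leqnn (50 * n ^ 2)) le3; lia.
Qed.

(** Telescoping: [r.+1 ^ 4 - r ^ 4 <= 4 * r.+1 ^ 3]. The slack at [k = 2], where [16 <= 32], makes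
    up for starting there. *)
Lemma pow4_le_sum_cubes r : 2 <= r -> r ^ 4 <= \sum_(2 <= k < r.+1) 4 * k ^ 3.
Proof.
elim: r => // -[|r] IH // _; case: r => [|r] in IH *; first by rewrite big_nat1.
rewrite big_nat_recr //=; have := IH isT; nia.
Qed.

(** Summation by layers: after exchanging sums, [card_rich_curves] bounds each of the fewer than [n]
    levels [k] by [4 * 200 * n ^ 4]. *)
Lemma sum_pow4_card_curve : \sum_(i | 2 <= #|S i|) #|S i| ^ 4 <= 800 * n ^ 5.
Proof.
apply: leq_trans (_ : \sum_i \sum_(2 <= k < n.+1 | k <= #|S i|) 4 * k ^ 3 <= _).
  rewrite [leqRHS](bigID (fun i => 2 <= #|S i|)) /=.
  apply: leq_trans (leq_addr _ _); apply: leq_sum => i Si.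
  apply: leq_trans (pow4_le_sum_cubes Si) _.
  have Sn := card_curve_le i.
  rewrite [leqRHS](big_cat_nat _ (n := #|S i|.+1)) //=; try lia.
  apply: leq_trans (leq_addr _ _); rewrite [leqRHS]big_nat_cond [leqLHS]big_nat.
  rewrite (eq_bigl (fun k => (2 <= k < #|S i|.+1) && (k <= #|S i|))) //.
  by move=> k; rewrite ltnS -andbA andbb.
rewrite (exchange_big_dep predT) //=.
apply: leq_trans (_ : \sum_(2 <= k < n.+1) 800 * n ^ 4 <= _).
  rewrite big_nat [leqRHS]big_nat; apply: leq_sum => k /andP[k2 _].
  rewrite sum_nat_const mulnCA (_ : 800 = 4 * 200) // -mulnA leq_mul2l /=.
  by have := card_rich_curves k2; rewrite cardsE.
by rewrite sum_nat_const_nat; nia.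
Qed.

End MonotoneGridCurves.

Local Open Scope fset_scope.
Local Open Scope ring_scope.

(** * Lines of nonzero slope as monotone curves in the grid [A * A] *)

Section AffineIncidences.
Variables (R : realFieldType) (A : {fset R}) (I : finType) (m b : I -> R).
Hypothesis m_neq0 : forall i, m i != 0.
Hypothesis mb_inj : forall i j, m i = m j -> b i = b j -> i = j.

Definition line_points i : {set A * A} :=
  [set p | val p.2 == m i * val p.1 + b i].

(** The position, from 0, in the increasing enumeration of [A]; it turns [A * A] into an integer
    grid. *)
Definition fset_rank (x : A) : nat := #|[set y : A | val y < val x]|.

Lemma fset_rank_mono : {mono fset_rank : x y / val x <= val y >-> (x <= y)%N}.
Proof.
move=> x y; case: (lerP (val x) (val y)) => xy.
  apply/subset_leq_card/subsetP => z; rewrite !inE => zx.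
  exact: lt_le_trans zx xy.
apply/negbTE; rewrite -ltnNge; apply/proper_card/properP; split.
  by apply/subsetP => z; rewrite !inE => /lt_trans; apply.
by exists y; rewrite !inE ?ltxx.
Qed.

Lemma fset_rank_inj : injective fset_rank.
Proof.
move=> x y xy; apply/val_inj/le_anti.
by rewrite -!fset_rank_mono xy leqnn.
Qed.

Lemma fset_rank_lt x : (fset_rank x < #|` A|)%N.
Proof.
rewrite cardfE -cardsT; apply/proper_card/properP; split=> //.
by exists x; rewrite !inE ?ltxx.
Qed.

Lemma line_points_mono i :
  {in line_points i &, forall p q,
     (fset_rank p.1 <= fset_rank q.1)%N = (fset_rank p.2 <= fset_rank q.2)%N} \/
  {in line_points i &, forall p q,
     (fset_rank p.1 <= fset_rank q.1)%N = (fset_rank q.2 <= fset_rank p.2)%N}.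
Proof.
case: (ltrgt0P (m i)) => [m0|m0|/eqP]; last by rewrite (negPf (m_neq0 i)).
  left=> p q; rewrite !inE !fset_rank_mono => /eqP -> /eqP ->.
  by rewrite lerD2r ler_pM2l.
right=> p q; rewrite !inE !fset_rank_mono => /eqP -> /eqP ->.
by rewrite lerD2r ler_nM2l.
Qed.

Lemma line_points_lin i j p q : p != q ->
  p \in line_points i -> q \in line_points i ->
  p \in line_points j -> q \in line_points j -> i = j.
Proof.
case: p q => [x y] [z t]; rewrite !inE /= => pq /eqP yi /eqP ti /eqP yj /eqP tj.
have xz : fsval x - fsval z != 0.
  rewrite subr_eq0; apply: contra pq => /eqP xz; apply/eqP; congr (_, _).
    exact: val_inj.
  by apply: val_inj; rewrite /= yi ti xz.
have mij : m i = m j.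
  apply: (mulIf xz); apply: (@etrans _ _ (fsval y - fsval t)).
    by rewrite yi ti; ring.
  by rewrite yj tj; ring.
by apply: mb_inj => //; apply: (addrI (m i * fsval x)); rewrite -yi {1}yj mij.
Qed.

Lemma sum_sqr_line_points :
  (\sum_(i | 2 <= #|line_points i|) #|line_points i| ^ 2 <= 2 * #|` A| ^ 4)%N.
Proof.
rewrite cardfE; exact: sum_sqr_card_curve line_points_lin.
Qed.

Lemma sum_pow4_line_points :
  (\sum_(i | 2 <= #|line_points i|) #|line_points i| ^ 4 <= 800 * #|` A| ^ 5)%N.
Proof.
have := fset_rank_lt; rewrite !cardfE => rank_lt.
exact: sum_pow4_card_curve fset_rank_inj rank_lt line_points_mono line_points_lin.
Qed.

End AffineIncidences.

(** * Energy as a second moment of the representation function *)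

Section Ratios.
Variables (G : groupType) (A : {fset G}).

(** Collecting the quotients in a finite set gives a finite index type for the sum of squares. *)
Definition ratios : {fset G} := [fset (l.1^-1 * l.2)%g | l in A `*` A].

Lemma ratio_subproof (l : A * A) : ((val l.1)^-1 * val l.2)%g \in ratios.
Proof.
apply/imfsetP; exists (val l.1, val l.2) => //=.
by rewrite !inE /= !fsvalP.
Qed.

Definition ratio (l : A * A) : ratios := [` ratio_subproof l].

Lemma energy_le_sum_ratio :
  (energy A <= \sum_(g : ratios) #|[set l | ratio l == g]| ^ 2)%N.
Proof.
rewrite -card_fiber_pairs cardE.
pose f (q : (A * A) * (A * A)) :=
  ((val q.1.1, val q.1.2), (val q.2.1, val q.2.2)).
rewrite -(size_map f); apply: uniq_leq_size; first exact: fset_uniq.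
move=> [[a b] [c d]]; rewrite !inE /= => /andP[/andP[/andP[Aa Ab] /andP[Ac Ad]] e].
apply/mapP; exists (([` Aa], [` Ab]), ([` Ac], [` Ad])) => //.
by rewrite mem_enum inE -val_eqE.
Qed.

End Ratios.

(** * Quotients of the given lines as affine maps acting on both [C] and [D] *)

Section LineRatios.
Variables (R : realFieldType) (C D : {fset R}) (lambda mu : R).
Hypotheses (lambda0 : lambda != 0) (mu0 : mu != 0).
Let L := lines C D lambda mu.

(* Recover [c] and [d] from the line [(lambda / (c - d), mu c / (c - d))]. *)
Definition line_c (l : aff R) := lambda / mu * ((val l).2 / (val l).1).
Definition line_d (l : aff R) := line_c l - lambda / (val l).1.

Lemma line_c_in (l : L) : line_c (val l) \in C.
Proof.
have /(linesP C D mu _ lambda0)[c [d [Cc _ cd lE]]] : val l \in lines C D lambda mu by exact: fsvalP.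
rewrite /line_c lE /=; suff -> : lambda / mu * (mu * c / (c - d) / (lambda / (c - d))) = c by [].
by field; rewrite lambda0 mu0 subr_eq0 cd.
Qed.

Lemma line_d_in (l : L) : line_d (val l) \in D.
Proof.
have /(linesP C D mu _ lambda0)[c [d [_ Dd cd lE]]] : val l \in lines C D lambda mu by exact: fsvalP.
rewrite /line_d /line_c lE /=.
suff -> : lambda / mu * (mu * c / (c - d) / (lambda / (c - d)))
          - lambda / (lambda / (c - d)) = d by [].
by field; rewrite lambda0 mu0 subr_eq0 cd.
Qed.

Lemma line_cd_inj l l' : line_c l = line_c l' -> line_d l = line_d l' -> l = l'.
Proof.
rewrite /line_d => ec; rewrite ec => /addrI/oppr_inj/(mulfI lambda0)/invr_inj em.
move: ec; rewrite /line_c => /(mulfI (mulf_neq0 lambda0 (invr_neq0 mu0))).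
rewrite em => /(mulIf (invr_neq0 (aff_slope_neq0 l'))) eb.
by apply: val_inj; move: em eb; case: (val l) (val l') => [? ?] [? ?] /= -> ->.
Qed.

(** For [g = (m, b)], the attached affine map is [x |-> m * x - (lambda / mu) * b]. *)
Definition ratio_slope (g : ratios L) := (val (val g)).1.
Definition ratio_shift (g : ratios L) := - (lambda / mu * (val (val g)).2).

Lemma ratio_slope_neq0 g : ratio_slope g != 0.
Proof. exact: aff_slope_neq0. Qed.

Lemma ratio_line_inj g h :
  ratio_slope g = ratio_slope h -> ratio_shift g = ratio_shift h -> g = h.
Proof.
rewrite /ratio_shift /ratio_slope.
move=> em /oppr_inj/(mulfI (mulf_neq0 lambda0 (invr_neq0 mu0))) eb.
apply/val_inj/val_inj.
by move: em eb; case: (val (val g)) (val (val h)) => [? ?] [? ?] /= -> ->.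
Qed.

Lemma ratio_line_c l : let g := ratio l in
  line_c (val l.1) = ratio_slope g * line_c (val l.2) + ratio_shift g.
Proof.
rewrite /ratio_slope /ratio_shift /line_c /=.
have := aff_slope_neq0 (val l.1); have := aff_slope_neq0 (val l.2) => /= h2 h1.
by field; rewrite mu0 h1 h2.
Qed.

(** The offset [c - d] is [lambda] over the slope of the line. Passing from the second line to the
    first multiplies it by [ratio_slope g], so the map that works for [c] also works for [d]. *)
Lemma ratio_line_d l : let g := ratio l in
  line_d (val l.1) = ratio_slope g * line_d (val l.2) + ratio_shift g.
Proof.
rewrite /ratio_slope /ratio_shift /line_d /line_c /=.
have := aff_slope_neq0 (val l.1); have := aff_slope_neq0 (val l.2) => /= h2 h1.
by field; rewrite mu0 h1 h2.
Qed.

Definition ratio_points (A : {fset R}) g :=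
  line_points A ratio_slope ratio_shift g.

Lemma sum_sqr_ratio_points A :
  (\sum_(g | 2 <= #|ratio_points A g|) #|ratio_points A g| ^ 2
     <= 2 * #|` A| ^ 4)%N.
Proof. exact: sum_sqr_line_points ratio_line_inj. Qed.

Lemma sum_pow4_ratio_points A :
  (\sum_(g | 2 <= #|ratio_points A g|) #|ratio_points A g| ^ 4
     <= 800 * #|` A| ^ 5)%N.
Proof. exact: sum_pow4_line_points ratio_slope_neq0 ratio_line_inj. Qed.

(** A pair of lines is recovered from the points [(c2, c1)] and [(d2, d1)], both of which lie on the
    line attached to [g]. *)
Lemma card_ratio_le g :
  (#|[set l | ratio l == g]| <= #|ratio_points C g| * #|ratio_points D g|)%N.
Proof.
rewrite -cardsX.
pose f (l : L * L) : (C * C) * (D * D) :=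
  (([` line_c_in l.2], [` line_c_in l.1]), ([` line_d_in l.2], [` line_d_in l.1])).
rewrite -(card_in_imset (f := f)) => [|[l1 l2] [k1 k2] _ _ [c2 c1 d2 d1]]; last first.
  by congr (_, _); apply/val_inj/line_cd_inj.
apply/subset_leq_card/subsetP => _ /imsetP[l + ->].
rewrite !inE => /eqP <- /=.
by rewrite ratio_line_c ratio_line_d !eqxx.
Qed.

Lemma card_lines_le : (#|` L| <= #|` C| * #|` D|)%N.
Proof.
rewrite !cardfE -card_prod.
apply: (leq_card (fun l : L => ([` line_c_in l], [` line_d_in l]))).
by move=> l k [c d]; apply/val_inj/line_cd_inj.
Qed.

End LineRatios.

(** * Combining the moments and concluding *)

(** Cauchy-Schwarz without square roots: sum the inequality [2 p q x ^ 2 y ^ 2 <= q ^ 2 x ^ 4 + p ^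
    2 y ^ 4]. It is applied with [p] and [q] the powers [5 / 2] of the two cardinals. *)
Lemma sum_sqr_prod_le (R : realFieldType) (I : finType) (P Q : pred I)
    (x y : I -> nat) (p q K : R) : 0 < p -> 0 < q ->
  (\sum_(i | P i) x i ^ 4)%N%:R <= K * p ^+ 2 ->
  (\sum_(i | Q i) y i ^ 4)%N%:R <= K * q ^+ 2 ->
  (\sum_(i | P i && Q i) x i ^ 2 * y i ^ 2)%N%:R <= K * (p * q).
Proof.
move=> p0 q0 lex ley.
have pq0 : 0 < 2 * (p * q) by rewrite !mulr_gt0.
rewrite -(ler_pM2l pq0).
have -> : 2 * (p * q) * (K * (p * q)) = q ^+ 2 * (K * p ^+ 2) + p ^+ 2 * (K * q ^+ 2).
  by ring.
apply: le_trans (lerD (ler_wpM2l (sqr_ge0 q) lex) (ler_wpM2l (sqr_ge0 p) ley)).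
apply: (@le_trans _ _ (\sum_(i | P i && Q i) q ^+ 2 * (x i ^ 4)%N%:R
                      + \sum_(i | P i && Q i) p ^+ 2 * (y i ^ 4)%N%:R)).
  rewrite -big_split /= natr_sum mulr_sumr; apply: ler_sum => i _.
  rewrite natrM !natrX -subr_ge0.
  suff -> : q ^+ 2 * (x i)%:R ^+ 4 + p ^+ 2 * (y i)%:R ^+ 4
       - 2 * (p * q) * ((x i)%:R ^+ 2 * (y i)%:R ^+ 2)
     = (q * (x i)%:R ^+ 2 - p * (y i)%:R ^+ 2) ^+ 2 by exact: sqr_ge0.
  by ring.
rewrite !natr_sum !mulr_sumr; apply: lerD.
  rewrite [leRHS](bigID Q) /= lerDl sumr_ge0 // => i _.
  by rewrite mulr_ge0 ?sqr_ge0.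
rewrite [leRHS](bigID P) /=; under eq_bigl do rewrite andbC.
by rewrite lerDl sumr_ge0 // => i _; rewrite mulr_ge0 ?sqr_ge0.
Qed.

(** If one of [x i], [y i] is at most 1, then [r i] is at most the other; if both are, then
    [r i <= 1] and [r i ^ 2 = r i]. *)
Lemma sum_sqr_split (I : finType) (r x y : I -> nat) :
  (forall i, r i <= x i * y i)%N ->
  (\sum_i r i ^ 2 <= \sum_i r i + \sum_(i | 2 <= x i) x i ^ 2
     + \sum_(i | 2 <= y i) y i ^ 2
     + \sum_(i | (2 <= x i) && (2 <= y i)) x i ^ 2 * y i ^ 2)%N.
Proof.
move=> rxy; rewrite ![X in (_ + X)%N]big_mkcond [X in (_ + X + _)%N]big_mkcond.
rewrite [X in (_ + X + _ + _)%N]big_mkcond -!big_split /=.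
apply: leq_sum => i _; have := rxy i.
have [x2|x1] := leqP 2 (x i); have [y2|y1] := leqP 2 (y i) => /= le.
- by rewrite -expnMn; apply: leq_trans (leq_addl _ _); rewrite leq_exp2r.
- have : (r i ^ 2 <= x i ^ 2)%N by rewrite leq_exp2r //; nia.
  by lia.
- have : (r i ^ 2 <= y i ^ 2)%N by rewrite leq_exp2r //; nia.
  by lia.
- have : (r i <= 1)%N by nia.
  by case: (r i) => [|[]].
Qed.

Lemma powR_half_sqr (R : realType) (n k : nat) :
  ((n%:R : R) `^ (k%:R / 2)) ^+ 2 = n%:R ^+ k.
Proof.
by rewrite -[LHS]powR_mulrn ?powR_ge0 // -powRrM divfK ?pnatr_eq0 // powR_mulrn.
Qed.

Theorem theorem2 (R : realType) :
  exists2 K : R, 0 < K &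
    forall (C D : {fset R}) (lambda mu : R), lambda != 0 -> mu != 0 ->
      (energy (lines C D lambda mu))%:R <=
        K * (#|` C|%:R `^ (5 / 2) * #|` D|%:R `^ (5 / 2)
             + #|` C|%:R ^+ 4 + #|` D|%:R ^+ 4).
Proof.
exists 800 => // C D lambda mu l0 m0.
set L := lines C D lambda mu; set c := #|` C|; set d := #|` D|.
set p := c%:R `^ _; set q := d%:R `^ _.
have pE : p ^+ 2 = c%:R ^+ 5 by exact: powR_half_sqr.
have qE : q ^+ 2 = d%:R ^+ 5 by exact: powR_half_sqr.
have leL : (#|` L| <= c * d)%N by exact: card_lines_le.
(* With [C] or [D] empty there are no lines; otherwise [p] and [q] are positive, as
   [sum_sqr_prod_le] requires. *)
have [cd0|] := posnP (c * d).
  suff -> : energy L = 0%N by rewrite mulr_ge0 // !addr_ge0 ?mulr_ge0 ?powR_ge0 ?exprn_ge0.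
  move: leL; rewrite cd0 leqn0 cardfs_eq0 => /eqP L0.
  apply/eqP; rewrite /energy cardfs_eq0; apply/eqP/fsetP => -[[a b] [u v]].
  by rewrite L0 !inE.
rewrite muln_gt0 => /andP[c0 d0].
have p0 : 0 < p by rewrite powR_gt0 ?ltr0n.
have q0 : 0 < q by rewrite powR_gt0 ?ltr0n.
have rs : (\sum_(g : ratios L) #|[set l | ratio l == g]| <= c ^ 2 * d ^ 2)%N.
  by rewrite sum_card_fibers card_prod -!cardfE -expnMn -mulnn leq_mul.
have sqC := sum_sqr_ratio_points C D l0 m0 C.
have sqD := sum_sqr_ratio_points C D l0 m0 D.
have pow4 (A : {fset R}) (z : R) : z ^+ 2 = #|` A|%:R ^+ 5 ->
    (\sum_(g : ratios L | 2 <= #|ratio_points A g|)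
        #|ratio_points A g| ^ 4)%N%:R <= 800 * z ^+ 2.
  by move=> ->; rewrite -natrX -natrM ler_nat sum_pow4_ratio_points.
have cs := sum_sqr_prod_le p0 q0 (pow4 C p pE) (pow4 D q qE).
have := leq_trans (energy_le_sum_ratio L)
  (sum_sqr_split (@card_ratio_le R C D lambda mu l0 m0)).
rewrite -(ler_nat R) => /le_trans; apply; rewrite natrD.
(* [s] gathers the terms without a fourth moment; its part [c ^ 2 * d ^ 2] is absorbed at the end by
   [2 c ^ 2 d ^ 2 <= c ^ 4 + d ^ 4]. *)
set s := (X in X%:R + _); have : (s <= c ^ 2 * d ^ 2 + 2 * c ^ 4 + 2 * d ^ 4)%N.
  by rewrite !leq_add.
rewrite -(ler_nat R) => /lerD-/(_ _ _ cs)/le_trans; apply.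
rewrite !natrD !natrM.
have : 0 <= (c%:R ^+ 2 - d%:R ^+ 2) ^+ 2 :> R by exact: sqr_ge0.
by have := sqr_ge0 (c%:R ^+ 2 : R); have := sqr_ge0 (d%:R ^+ 2 : R); nra.
Qed.
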